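(* For every integer $n\geq 1$, \[\overline{pl}(n)\equiv \overline{p}_{o}(n)\equiv \begin{cases} 2 \pmod 4 & \text{if } n \text{ is a square or twice a square},\\ 0 \pmod 4 & \text{otherwise.}\end{cases}\]
   Context: A plane overpartition of $n$ is a plane partition of $n$ (an array $(\pi_{ij})_{i,j\geq1}$ of nonnegative integers, weakly decreasing along rows and down columns, with $\sum\pi_{ij}=n$) in which entries may be overlined subject to: in each row, the last occurrence of an integer may be overlined or not and all other occurrences of that integer in the row are not overlined; in each column, the first occurrence of an integer may be overlined or not and all other occurrences of that integer in the column are overlined. $\overline{pl}(n)$ denotes the number of plane overpartitions of $n$ ($\overline{pl}(0)=1$); its generating function is $\sum_{n\geq0}\overline{pl}(n)q^n=\prod_{n\geq1}\frac{(1+q^n)^n}{(1-q^n)^n}$. An overpartition of $n$ is a partition of $n$ in which the first occurrence of each part may be overlined; $\overline{p}_o(n)$ is the number of overpartitions of $n$ into odd parts ($\overline{p}_o(0)=1$), with generating function $\prod_{n\geq1}\frac{1+q^{2n-1}}{1-q^{2n-1}}$. *)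

(* Defs.v *)
From mathcomp Require Export all_boot.

Set Implicit Arguments.
Unset Strict Implicit.
Unset Printing Implicit Defensive.

(* An array of nonnegative integers that decreases weakly along rows and down
   columns and has sum n vanishes outside its first n rows and columns (a
   positive entry in row or column n + 1 forces n + 1 positive entries), and its
   entries are at most n. Plane overpartitions of n are therefore encoded as an
   n x n array of entries in {0, ..., n}, paired with the set of overlined
   cells; zero entries are not parts and are never overlined. Indices start
   at 0, and the first index is the row. *)
Definition plane_array (n : nat) : finType :=
  ({ffun 'I_n * 'I_n -> 'I_n.+1} * {set 'I_n * 'I_n})%type.

Definition is_plane_partition (n : nat) (a : {ffun 'I_n * 'I_n -> 'I_n.+1}) :=
  [&& [forall i : 'I_n, forall j : 'I_n, forall j' : 'I_n,
        (j <= j') ==> (a (i, j') <= a (i, j))],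
      [forall i : 'I_n, forall i' : 'I_n, forall j : 'I_n,
        (i <= i') ==> (a (i', j) <= a (i, j))]
    & \sum_(i < n) \sum_(j < n) a (i, j) == n].

Definition is_plane_overpartition (n : nat) (p : plane_array n) :=
  let: (a, V) := p in
  [&& is_plane_partition a,
      [forall i : 'I_n, forall j : 'I_n, ((i, j) \in V) ==> (0 < a (i, j))],
      (* an entry that is not the last of its value in its row *)
      [forall i : 'I_n, forall j : 'I_n, forall j' : 'I_n,
        [&& j < j', a (i, j') == a (i, j) & 0 < a (i, j)]
          ==> ((i, j) \notin V)]
    & (* an entry that is not the first of its value in its column *)
      [forall i : 'I_n, forall i' : 'I_n, forall j : 'I_n,
        [&& i' < i, a (i', j) == a (i, j) & 0 < a (i, j)]
          ==> ((i, j) \in V)]].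

Definition plbar (n : nat) : nat :=
  #|[set p : plane_array n | is_plane_overpartition p]|.

(* A partition of n has at most n parts, each at most n: it is encoded as its
   weakly decreasing list of parts, padded with zeros to length n, and paired
   with the set of positions of the overlined parts. *)
Definition part_array (n : nat) : finType :=
  ({ffun 'I_n -> 'I_n.+1} * {set 'I_n})%type.

Definition is_partition (n : nat) (a : {ffun 'I_n -> 'I_n.+1}) :=
  [forall j : 'I_n, forall j' : 'I_n, (j <= j') ==> (a j' <= a j)]
  && (\sum_(j < n) a j == n).

Definition is_overpartition (n : nat) (p : part_array n) :=
  let: (a, V) := p in
  [&& is_partition a,
      [forall j : 'I_n, (j \in V) ==> (0 < a j)]
    & (* a part that is not the first of its value *)
      [forall j : 'I_n, forall j' : 'I_n,
        [&& j' < j & a j' == a j] ==> (j \notin V)]].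

Definition has_odd_parts (n : nat) (p : part_array n) :=
  [forall j : 'I_n, (0 < p.1 j) ==> odd (p.1 j)].

Definition pobar (n : nat) : nat :=
  #|[set p : part_array n | is_overpartition p && has_odd_parts p]|.

Definition square_or_twice_square (n : nat) : Prop :=
  (exists k, n = k ^ 2) \/ (exists k, n = 2 * k ^ 2).

(* Main.v *)
(* For a fixed array, the admissible sets of overlined cells form an interval
   [A, B] of the subset lattice, so there are 2^#|B \ A| of them (or none).
   Every positive value occurring in the array owns a cell of B \ A (topmost row
   containing it, last occurrence there), so modulo 4 only the arrays with
   exactly one such cell count, each contributing 2.  For plane overpartitions
   these are the hooks filled with a constant v, giving \sum_(v | n) n / v of
   them; for overpartitions into odd parts they are the constant partitions, one
   for each odd divisor of n.  Both numbers have the parity of the number of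
   divisors of the odd part of n, which is odd iff that part is a square. *)
Require Import Defs.
From mathcomp Require Import all_boot zify.

(** * Counting pairs fibred in subset intervals, modulo 4 *)

Lemma card_subset_interval (T : finType) (A B : {set T}) :
  A \subset B ->
  #|[set V : {set T} | (A \subset V) && (V \subset B)]| = 2 ^ #|B :\: A|.
Proof.
move=> sAB; rewrite -card_powerset.
have inj : {in powerset (B :\: A) &, injective (fun W => A :|: W)}.
  have K W : W \in powerset (B :\: A) -> (A :|: W) :\: A = W.
    rewrite inE subsetD => /andP[_ dWA].
    by rewrite setDUl setDv set0U; apply/setDidPl.
  by move=> W W' /K {2}<- /K {2}<- ->.
rewrite -(card_in_imset inj); apply: eq_card => V; rewrite inE.
apply/andP/imsetP => [[sAV sVB]|[W]].
  exists (V :\: A); first by rewrite inE setSD.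
  apply/setP=> x; rewrite !inE.
  by case: (boolP (x \in A)) => //= /(subsetP sAV) ->.
rewrite inE subsetD => /andP[sWB _] ->.
by rewrite subsetUl subUset sAB.
Qed.

(** The fibre over [a] is empty or has 2 ^ k elements with k = [#|B a :\: A a|]. Positivity excludes
    k = 0, and k >= 2 contributes 0 modulo 4, so only k = 1 survives. *)
Lemma card_interval_pairs_mod4 (I T : finType) (P : pred (I * {set T}))
    (Q : pred I) (A B : I -> {set T}) :
  (forall a V, P (a, V) = [&& Q a, A a \subset V & V \subset B a]) ->
  (forall a, Q a -> 0 < #|B a :\: A a|) ->
  #|[set p | P p]| =
    2 * #|[set a | [&& Q a, A a \subset B a & #|B a :\: A a| == 1]]| %[mod 4].
Proof.
move=> PE Bpos.
have -> : #|[set p | P p]| = \sum_a #|[set V | P (a, V)]|.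
  rewrite -sum1_card (eq_bigl P) => [|p]; last by rewrite inE.
  rewrite big_mkcond /=.
  rewrite (eq_bigr (fun p => if P (p.1, p.2) then 1 else 0)) => [|[]//].
  rewrite -(pair_bigA _ (fun a V => if P (a, V) then 1 else 0)) /=.
  apply: eq_bigr => a _; rewrite -big_mkcond -sum1_card.
  by apply: eq_bigl => V; rewrite inE.
rewrite -sum1_card big_distrr /= [in RHS]big_mkcond /=.
elim/big_ind2: _ => // [m1 m2 k1 k2 E1 E2|a _].
  by rewrite -modnDm E1 E2 modnDm.
rewrite inE.
have -> : [set V | P (a, V)] =
    [set V : {set T} | [&& Q a, A a \subset V & V \subset B a]].
  by apply/setP => V; rewrite !inE PE.
case: (boolP (Q a)) => /= [Qa|_]; last by rewrite eq_card0 // => V; rewrite inE.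
case: (boolP (A a \subset B a)) => /= [sAB|nsAB]; last first.
  rewrite eq_card0 // => V; rewrite inE; apply/negbTE.
  by apply: contra nsAB => /andP[]; apply: subset_trans.
rewrite card_subset_interval //.
case: #|_| (Bpos _ Qa) => [|[|k]] // _.
by rewrite !expnS mulnA modnMr.
Qed.

(** Used to see that the positive entries of a weakly decreasing row or column fill an initial
    segment. *)
Lemma down_closed_ord (n : nat) (P : pred 'I_n) :
  (forall j j' : 'I_n, j <= j' -> P j' -> P j) ->
  exists2 r, r <= n & forall j : 'I_n, P j = (j < r).
Proof.
(* The successor makes the empty predicate correspond to [r = 0]. *)
move=> dP; exists (\max_(j | P j) j.+1); first by apply/bigmax_leqP.
move=> j; apply/idP/idP => [Pj|]; first exact: (@leq_bigmax_cond _ P (fun j : 'I_n => j.+1)).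
apply: contraTT => nPj; rewrite -leqNgt; apply/bigmax_leqP => k Pk.
by rewrite ltnNge; apply: contra nPj => /dP; apply.
Qed.

Lemma sum_ord_threshold (n r v : nat) :
  r <= n -> \sum_(j < n) (if j < r then v else 0) = r * v.
Proof.
move=> ler; rewrite -big_mkcond /= -(big_ord_widen n (fun=> v) ler).
by rewrite sum_nat_const card_ord.
Qed.

(** * Parity of the number of odd divisors *)

Definition odd_divisors (n : nat) : {set 'I_n.+1} :=
  [set v : 'I_n.+1 | odd v && (v %| n)].

(** The odd divisors of [n] are the divisors of its odd part [o]. The involution v -> o / v pairs
    them off except for a possible square root of [o], and [o] is a square iff [n] is a square or
    twice one. *)
Lemma odd_odd_divisors (n : nat) : 0 < n ->
  odd #|odd_divisors n| <-> square_or_twice_square n.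
Proof.
move=> n_gt0; pose o := n`_2^'.
have o_gt0 : 0 < o by exact: part_gt0.
have odd_o : odd o by rewrite odd_2'nat part_pnat.
have on : o %| n by exact: dvdn_part.
have divE v : odd v && (v %| n) = (v %| o).
  apply/andP/idP => [[ov vn]|vo]; last first.
    by rewrite (dvdn_odd vo odd_o) (dvdn_trans vo on).
  move: vn; rewrite -(partnC 2 n_gt0) Gauss_dvdr// p_part.
  by rewrite coprimeXr // coprimen2.
(* Divisors of [o] below, above and equal to its square root; [f] below exchanges [S] and [L]. *)
pose S := [set v : 'I_n.+1 | (v %| o) && (v * v < o)].
pose L := [set v : 'I_n.+1 | (v %| o) && (o < v * v)].
pose E := [set v : 'I_n.+1 | v * v == o].
have cardE : #|odd_divisors n| = #|S| + #|L| + #|E|.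
  have cE (D : {set 'I_n.+1}) : #|D| = \sum_v (v \in D).
    by rewrite -sum1_card big_mkcond; apply: eq_bigr => v _; case: ifP.
  rewrite !cE -!big_split /=; apply: eq_bigr => v _; rewrite !inE divE.
  case: (ltngtP (v * v) o) => [h|h|h]; rewrite ?andbT ?andbF //.
  - by case: (_ %| _).
  - by case: (_ %| _).
  - by rewrite -h dvdn_mulr.
have lt_n v : o %/ v < n.+1.
  by rewrite ltnS (leq_trans (leq_div _ _) (dvdn_leq n_gt0 on)).
pose f (v : 'I_n.+1) : 'I_n.+1 := inord (o %/ v).
have fE v : f v = o %/ v :> nat by rewrite inordK ?lt_n.
have fK (v : 'I_n.+1) : v %| o -> f (f v) = v.
  move=> vo; apply: val_inj => /=; rewrite !fE.
  by rewrite divnA // mulKn.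
have v_gt0 (v : nat) : v %| o -> 0 < v by move=> vo; apply: dvdn_gt0 vo.
have SL : #|S| = #|L|.
  have -> : L = f @: S.
    apply/setP => w; rewrite inE; apply/andP/imsetP => [[wo ow]|[v]].
      exists (f w); last by rewrite fK.
      rewrite inE fE // dvdn_div //=; move/dvdnP: (wo) ow o_gt0 => [k ->].
      by rewrite mulnK ?(v_gt0 _ wo) //; nia.
    rewrite inE => /andP[vo ltv] ->; rewrite fE // dvdn_div //.
    move/dvdnP: (vo) ltv o_gt0 => [k ->]; rewrite mulnK ?(v_gt0 _ vo) //; nia.
  rewrite card_in_imset // => v w; rewrite !inE => /andP[/fK fv _].
  by move=> /andP[/fK fw _] eqf; rewrite -fv eqf.
rewrite cardE SL addnn oddD odd_double /=.
have cE : #|E| <= 1.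
  apply/card_le1_eqP => v w; rewrite !inE => /eqP <- /eqP vw.
  by apply: val_inj => /=; nia.
split.
  case: (set_0Vmem E) => [->|[v]]; first by rewrite cards0.
  rewrite inE => /eqP vo _.
  (* Now n = 2 ^ k * v ^ 2: an even [k] gives a square, an odd [k] twice a square. *)
  have nE := partnC 2 n_gt0; rewrite -/o -vo p_part in nE.
  move: (logn 2 n) nE => k <-.
  rewrite -(odd_double_half k); case: (odd k); [right|left].
    exists (2 ^ k./2 * v); rewrite /= add1n expnS -muln2 expnM; lia.
  exists (2 ^ k./2 * v); rewrite /= add0n -muln2 expnM; lia.
suff sq : square_or_twice_square n -> exists b, o = b ^ 2.
  move=> /sq[b ob]; suff -> : #|E| = 1 by [].
  apply/eqP; rewrite eqn_leq cE /=; apply/card_gt0P.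
  have bn : b < n.+1 by have := dvdn_leq n_gt0 on; nia.
  by exists (Ordinal bn); rewrite inE /= ob mulnn.
(* Taking odd parts is multiplicative and sends 2 to 1, so in both cases [o] is the square of the
   odd part of [k]. *)
case=> -[k nk]; exists (k`_2^'); rewrite /o nk ?partnX //.
rewrite partnM ?partnX ?expn_gt0 //; last by move: n_gt0; rewrite nk; case: (k).
by rewrite (_ : 2`_2^' = 1) ?mul1n // part_p'nat // pnatNK pnat_id.
Qed.

(** The involution v -> n / v turns the sum into the sum of the divisors, where only odd terms
    affect the parity. *)
Lemma sum_codivisors_odd (n : nat) : 0 < n ->
  odd (\sum_(v < n.+1 | v %| n) n %/ v) = odd #|odd_divisors n|.
Proof.
move=> n_gt0.
have -> : \sum_(v < n.+1 | v %| n) n %/ v = \sum_(v < n.+1 | v %| n) v.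
  pose f (v : 'I_n.+1) : 'I_n.+1 := inord (n %/ v).
  have fE v : f v = n %/ v :> nat by rewrite inordK // ltnS leq_div.
  rewrite [RHS](reindex_onto f f) => [|v vn] /=; last first.
    by apply: val_inj; rewrite /= !fE divnA // mulKn.
  apply: eq_big => [v|v _]; rewrite ?fE //.
  apply/idP/andP => [vn|[vn /eqP/(congr1 val) /=]].
    by rewrite dvdn_div //; split=> //; apply/eqP/val_inj; rewrite /= !fE divnA // mulKn.
  by rewrite !fE => <-; rewrite dvdn_div.
rewrite -sum1_card big_mkcond [in RHS]big_mkcond /=.
elim/big_ind2: _ => // [m1 m2 k1 k2 E1 E2|v _]; first by rewrite !oddD E1 E2.
by rewrite inE andbC; case: (v %| n) => //=; case: (odd v).
Qed.

(** * Overpartitions into odd parts, modulo 4 *)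

Lemma pobar_mod4 (n : nat) : 0 < n -> pobar n = 2 * #|odd_divisors n| %[mod 4].
Proof.
case: n => // m _; set n := m.+1.
(* The positions that may be overlined. None is forced, so the lower end of the interval is
   [set0]. *)
pose B (a : {ffun 'I_n -> 'I_n.+1}) := [set j : 'I_n |
  (0 < a j) && [forall j' : 'I_n, (j' < j) ==> (a j' != a j)]].
pose Q (a : {ffun 'I_n -> 'I_n.+1}) :=
  is_partition a && [forall j : 'I_n, (0 < a j) ==> odd (a j)].
have first_occ (a : {ffun 'I_n -> 'I_n.+1}) j : 0 < a j -> exists2 k, k \in B a & a k = a j.
  move=> aj; case: (@arg_minnP _ j (fun k => a k == a j) val (eqxx _)).
  move=> k /eqP ak kmin; exists k => //; rewrite inE ak aj /=.
  apply/forallP => j'; apply/implyP => ltj'.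
  by apply/negP => /kmin /=; rewrite leqNgt ltj'.
have a0_gt0 a : Q a -> 0 < a ord0.
  move=> /andP[/andP[/forallP mono /eqP sumn] _]; rewrite lt0n; apply/eqP => a0.
  suff: n = 0 by []; rewrite -[LHS]sumn big1 // => j _.
  move/forallP: (mono ord0) => /(_ j) /implyP /(_ isT).
  by rewrite a0 leqn0 => /eqP.
(* The partition of [n] into n / v copies of [v], padded with zeros. *)
pose g (v : 'I_n.+1) : {ffun 'I_n -> 'I_n.+1} :=
  [ffun j : 'I_n => if j < n %/ v then v else ord0].
have gpos (v : 'I_n.+1) j : v %| n -> (0 < g v j) = (j < n %/ v).
  by move=> vn; rewrite ffunE; case: ifP => // _; apply: dvdn_gt0 vn.
have g0 (v : 'I_n.+1) : v %| n -> g v ord0 = v.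
  by move=> vn; rewrite ffunE divn_gt0 ?(dvdn_gt0 _ vn) // dvdn_leq.
rewrite /pobar (card_interval_pairs_mod4 _ _ _ Q (fun=> set0) B); first last.
- move=> a /a0_gt0 /first_occ[k kB _]; apply/card_gt0P; exists k.
  by rewrite setD0.
- move=> a V; rewrite /Q sub0set /= /is_overpartition /has_odd_parts /=.
  rewrite -andbA [X in _ && X]andbC -andbA; congr (_ && (_ && _)).
  apply/andP/subsetP => [[/forallP Vpos /forallP Vfirst] j jV|sVB].
    rewrite inE (implyP (Vpos j) jV) /=; apply/forallP => j'.
    apply/implyP => ltj'; apply/negP => eqa.
    by move/forallP: (Vfirst j) => /(_ j'); rewrite ltj' eqa jV.
  split; apply/forallP => j.
    by apply/implyP => /sVB; rewrite inE => /andP[].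
  apply/forallP => j'; apply/implyP => /andP[ltj' eqa]; apply/negP => /sVB.
  by rewrite inE => /andP[_ /forallP/(_ j')]; rewrite ltj' eqa.
suff -> : [set a | [&& Q a, set0 \subset B a & #|B a :\: set0| == 1]] =
          g @: odd_divisors n.
  rewrite card_in_imset // => v w; rewrite !inE => /andP[_ vn] /andP[_ wn] gvw.
  by rewrite -(g0 v vn) gvw g0.
apply/setP => a; rewrite inE sub0set setD0 /=; apply/andP/imsetP.
  move=> [Qa /cards1P[k Bk]]; have a0 := a0_gt0 a Qa.
  have /andP[/andP[/forallP mono /eqP sumn] /forallP aodd] := Qa.
  (* Each positive value has its first occurrence in [B a], which is a singleton, so there is only
     one such value. *)
  have const j : 0 < a j -> a j = a ord0.
    move=> /first_occ[k1]; have [k2] := first_occ _ _ a0.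
    by rewrite Bk !inE => /eqP -> <- /eqP -> <-.
  have [|r ler rE] := @down_closed_ord n (fun j => 0 < a j).
    move=> j j' lejj' aj'; apply: leq_trans aj' _.
    by move/forallP: (mono j) => /(_ j'); rewrite lejj'.
  have aE j : a j = if j < r then a ord0 else ord0.
    rewrite -rE; case: ifPn => [/const //|].
    by rewrite -eqn0Ngt => /eqP aj; apply: val_inj.
  have nE : n = r * a ord0.
    rewrite -(sum_ord_threshold _ _ _ ler) -[LHS]sumn.
    by apply: eq_bigr => j _; rewrite (aE j); case: ifP.
  have an : a ord0 %| n by rewrite [X in _ %| X]nE dvdn_mull.
  have nvE : n %/ a ord0 = r by rewrite [X in X %/ _]nE mulnK.
  exists (a ord0); first by rewrite inE an (implyP (aodd ord0) a0).
  by apply/ffunP => j; rewrite ffunE nvE.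
move=> [v]; rewrite inE => /andP[vodd vn] ->.
have nv_gt0 : 0 < n %/ v by rewrite -(gpos v ord0 vn) g0 // (dvdn_gt0 _ vn).
split; last first.
  apply/cards1P; exists ord0; apply/setP => j; rewrite !inE gpos //.
  apply/andP/eqP => [[ltj /forallP/(_ ord0)]|->]; last first.
    by split=> //; apply/forallP => j'.
  rewrite !ffunE ltj nv_gt0 eqxx implybF -leqNgt leqn0 => /eqP j0.
  exact: val_inj.
apply/andP; split; last first.
  by apply/forallP => j; rewrite gpos // ffunE; apply/implyP => ->.
apply/andP; split.
  apply/forallP => j; apply/forallP => j'; apply/implyP => lejj'; rewrite !ffunE.
  by case: ifP => // ltj'; rewrite (leq_ltn_trans lejj' ltj').
apply/eqP; rewrite -[RHS](divnK vn) -(@sum_ord_threshold n) ?leq_div //.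
by apply: eq_bigr => j _; rewrite ffunE; case: ifP.
Qed.

(** * Constant hooks and plane overpartitions, modulo 4 *)

Definition hook (m : nat) (v : 'I_m.+2) (r l : nat) :
    {ffun 'I_m.+1 * 'I_m.+1 -> 'I_m.+2} :=
  [ffun c : 'I_m.+1 * 'I_m.+1 =>
    if (c.1 == 0 :> nat) && (c.2 < r) || (c.2 == 0 :> nat) && (c.1 < l)
    then v else ord0].

(** The corner is counted with the first row, whence [l.-1] for the rest of the column. *)
Lemma sum_hook (m : nat) (v : 'I_m.+2) (r l : nat) :
  0 < r <= m.+1 -> 0 < l <= m.+1 ->
  \sum_(i < m.+1) \sum_(j < m.+1) hook m v r l (i, j) = (r + l.-1) * v.
Proof.
move=> /andP[r_gt0 ler] /andP[l_gt0 lel]; rewrite big_ord_recl mulnDl; congr (_ + _).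
  rewrite -(@sum_ord_threshold m.+1) //; apply: eq_bigr => j _; rewrite ffunE /= l_gt0 andbT.
  by case: (nat_of_ord j) => [|k]; rewrite ?r_gt0 ?orbF //=; case: ifP.
have lel' : l.-1 <= m by rewrite -ltnS prednK.
rewrite -(sum_ord_threshold _ _ _ lel'); apply: eq_bigr => i _.
rewrite big_ord_recl big1 ?addn0 => [|j _]; last by rewrite ffunE.
have -> : (i < l.-1) = (i.+1 < l) by lia.
by rewrite ffunE /=; case: ifP.
Qed.

Lemma plbar_mod4 (n : nat) : 0 < n ->
  plbar n = 2 * \sum_(v < n.+1 | v %| n) n %/ v %[mod 4].
Proof.
case: n => // m _; set n := m.+1.
(* [A a] holds the cells that the column rule forces to be overlined, [B a] those that the row rule
   allows to be. *)
pose A (a : {ffun 'I_n * 'I_n -> 'I_n.+1}) := [set c : 'I_n * 'I_n |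
  (0 < a c) && [exists i : 'I_n, (i < c.1) && (a (i, c.2) == a c)]].
pose B (a : {ffun 'I_n * 'I_n -> 'I_n.+1}) := [set c : 'I_n * 'I_n |
  (0 < a c) && [forall j : 'I_n, (c.2 < j) ==> (a (c.1, j) != a c)]].
(* In the topmost row containing the value, its last occurrence is free: nothing equal stands above
   it or to its right. *)
have own_cell (a : {ffun 'I_n * 'I_n -> 'I_n.+1}) c : 0 < a c -> exists2 d, d \in B a :\: A a & a d = a c.
  move=> ac; case: (@arg_minnP _ c (fun d => a d == a c) (fun d => d.1) (eqxx _)).
  move=> [i j] /eqP aij imin.
  case: (@arg_maxnP _ j (fun k => a (i, k) == a c) val); first exact/eqP.
  move=> k /eqP aik kmax; exists (i, k) => //; rewrite !inE aik ac /=.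
  apply/andP; split.
    by apply/existsPn => i'; apply/negP => /andP[lti' /imin /=]; rewrite leqNgt lti'.
  apply/forallP => j'; apply/implyP => ltj'.
  by apply/negP => /kmax /=; rewrite leqNgt ltj'.
have ppP (a : {ffun 'I_n * 'I_n -> 'I_n.+1}) : is_plane_partition a ->
    [/\ forall i j j' : 'I_n, j <= j' -> a (i, j') <= a (i, j),
        forall i i' j : 'I_n, i <= i' -> a (i', j) <= a (i, j)
      & \sum_(i < n) \sum_(j < n) a (i, j) = n].
  move=> /and3P[/forallP rows /forallP cols /eqP sumn]; split=> //.
    by move=> i j j'; move/forallP: (rows i) => /(_ j) /forallP /(_ j') /implyP.
  by move=> i i' j; move/forallP: (cols i) => /(_ i') /forallP /(_ j) /implyP.
have a0_gt0 (a : {ffun 'I_n * 'I_n -> 'I_n.+1}) : is_plane_partition a -> 0 < a (ord0, ord0).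
  move=> /ppP[rows cols sumn]; rewrite lt0n; apply/eqP => a0.
  suff: n = 0 by []; rewrite -[LHS]sumn big1 // => i _; rewrite big1 // => j _.
  apply/eqP; rewrite -leqn0 -a0; apply: leq_trans (cols ord0 i ord0 _) => //.
  exact: rows.
rewrite /plbar (card_interval_pairs_mod4 _ _ _ (@is_plane_partition n) A B); first last.
- by move=> a /a0_gt0 /own_cell[k kB _]; apply/card_gt0P; exists k.
- move=> a V; rewrite /is_plane_overpartition; congr (_ && _).
  apply/and3P/andP => [[/forallP Vpos /forallP Vrow /forallP Vcol]|[/subsetP sAV /subsetP sVB]].
    split; apply/subsetP => -[i j].
      rewrite inE /= => /andP[aij /existsP[i' /andP[lti' eqa]]].
      move/forallP: (Vcol i) => /(_ i') /forallP /(_ j) /implyP; apply.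
      exact/and3P.
    move=> ijV; rewrite inE /=.
    have aij : 0 < a (i, j).
      by move/forallP: (Vpos i) => /(_ j) /implyP; apply.
    rewrite aij /=; apply/forallP => j'; apply/implyP => ltj'; apply/negP => eqa.
    move/forallP: (Vrow i) => /(_ j) /forallP /(_ j').
    by rewrite ltj' eqa aij ijV.
  split; apply/forallP => i; apply/forallP.
  + by move=> j; apply/implyP => /sVB; rewrite inE => /andP[].
  + move=> j; apply/forallP => j'; apply/implyP => /and3P[ltj' eqa aij].
    apply/negP => /sVB; rewrite inE /= => /andP[_ /forallP /(_ j')].
    by rewrite ltj' eqa.
  + move=> i'; apply/forallP => j; apply/implyP => /and3P[lti' eqa aij].
    by apply: sAV; rewrite inE aij /=; apply/existsP; exists i'; rewrite lti'.
(* A pair (v, r) encodes the hook of value [v] with r + 1 cells in the first row and n / v - r in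
   the first column; as the corner is shared, it has n / v cells. *)
pose J := [set p : 'I_n.+1 * 'I_n | (p.1 %| n) && (p.2 < n %/ p.1)].
pose h (p : 'I_n.+1 * 'I_n) := hook m p.1 p.2.+1 (n %/ p.1 - p.2).
have cardJ : #|J| = \sum_(v < n.+1 | v %| n) n %/ v.
  rewrite -sum1dep_card -(pair_big_dep (fun v : 'I_n.+1 => v %| n)
    (fun (v : 'I_n.+1) (j : 'I_n) => j < n %/ v) (fun _ _ => 1)) /=.
  apply: eq_bigr => v _; rewrite big_mkcond /= sum_ord_threshold ?muln1 //.
  exact: leq_div.
rewrite -cardJ; congr (2 * _ %% 4).
(* The corner entry recovers [v], and the support of the first row recovers [r]. *)
have injh : {in J &, injective h}.
  move=> [v r] [w s]; rewrite !inE /= => /andP[vn rv] /andP[wn sw]; rewrite /h /= => eqh.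
  have vw : v = w.
    have := congr1 (fun f : {ffun _ -> _} => f (ord0, ord0)) eqh.
    by rewrite !ffunE.
  rewrite -{}vw in wn sw eqh *; congr (_, _); apply: val_inj => /=.
  have v_gt0 : 0 < v by apply: dvdn_gt0 vn.
  have rowE (u : nat) (j : 'I_n) : u < n %/ v ->
      (0 < hook m v u.+1 (n %/ v - u) (ord0, j)) = (j <= u).
    move=> ltu; rewrite ffunE /= ltnS subn_gt0 ltu andbT.
    by case: (nat_of_ord j) => [|k]; rewrite ?leq0n ?orbF //=; case: ifP.
  apply/eqP; rewrite eqn_leq; apply/andP; split.
    by rewrite -(rowE _ r sw) -eqh rowE.
  by rewrite -(rowE _ s rv) eqh rowE.
rewrite -(card_in_imset injh); apply: eq_card => a; rewrite inE.
apply/and3P/imsetP => [[Qa sAB /cards1P[k Dk]]|[[v r]]].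
  have a0 := a0_gt0 a Qa; have [rows cols sumn] := ppP a Qa.
  set v := a (ord0, ord0) in a0.
  have const c : 0 < a c -> a c = v.
    move=> /own_cell[k1]; have [k2] := own_cell _ _ a0.
    by rewrite Dk !inE => /eqP -> akv /eqP -> <-.
  (* A positive entry off the first row and column would force the cell to its
     left to be both overlined and not overlined. *)
  have off_hook (i j : 'I_n) : 0 < i -> 0 < j -> a (i, j) = ord0.
    move=> i_gt0 j_gt0; apply: val_inj; apply/eqP; apply: contraT.
    rewrite -lt0n /= => aij.
    have ai0 : 0 < a (i, ord0) by apply: leq_trans aij (rows _ _ _ _).
    have: (i, ord0) \in B a.
      apply: (subsetP sAB); rewrite inE ai0; apply/existsP; exists ord0.
      by rewrite i_gt0 (const _ ai0) /=.
    rewrite inE => /andP[_ /forallP /(_ j)].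
    by rewrite j_gt0 (const _ aij) (const _ ai0) eqxx.
  have [j j' lej|r ler rE] := @down_closed_ord n (fun j => 0 < a (ord0, j)).
    by move=> /leq_trans; apply; apply: rows.
  have [i i' lei|l lel lE] := @down_closed_ord n (fun i => 0 < a (i, ord0)).
    by move=> /leq_trans; apply; apply: cols.
  have r_gt0 : 0 < r by rewrite -(rE ord0).
  have l_gt0 : 0 < l by rewrite -(lE ord0).
  have aE : a = hook m v r l.
    apply/ffunP => -[i j]; rewrite ffunE /=.
    have posE c : a c = if 0 < a c then v else ord0.
      by case: ifPn => [/const //|]; rewrite -eqn0Ngt => /eqP ac; apply: val_inj.
    case: (posnP i) => [i0|i_gt0] /=.
      have -> : i = ord0 by apply: val_inj.
      rewrite [LHS]posE rE l_gt0 andbT.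
      by case: (nat_of_ord j) => [|k']; rewrite ?r_gt0 ?orbF.
    case: (posnP j) => [j0|j_gt0] /=; last by rewrite off_hook.
    have -> : j = ord0 by apply: val_inj.
    by rewrite [LHS]posE lE.
  have nE : n = (r + l.-1) * v by rewrite -[LHS]sumn aE sum_hook ?r_gt0 ?l_gt0.
  have nvE : n %/ v = r + l.-1 by rewrite [X in X %/ _]nE mulnK.
  have ltr : r.-1 < n by rewrite prednK.
  exists (v, Ordinal ltr); first by rewrite inE /= nvE [X in _ %| X]nE dvdn_mull //=; lia.
  rewrite aE /h /= nvE prednK //; congr hook; lia.
rewrite inE /= => /andP[vn rv] ->; rewrite /h /=.
have v_gt0 : 0 < v by apply: dvdn_gt0 vn.
have nv_le : n %/ v <= n by exact: leq_div.
set l := n %/ v - r; have l_gt0 : 0 < l by rewrite subn_gt0.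
have lel : l <= n by apply: leq_trans nv_le; apply: leq_subr.
have hpos c : (0 < hook m v r.+1 l c) =
    (c.1 == 0 :> nat) && (c.2 < r.+1) || (c.2 == 0 :> nat) && (c.1 < l).
  by rewrite ffunE; case: ifP.
have hE c : 0 < hook m v r.+1 l c -> hook m v r.+1 l c = v.
  by rewrite hpos ffunE => ->.
(* Entries are 0 or [v], so monotonicity reduces to an inclusion between supports. *)
have hmono c d : (0 < hook m v r.+1 l c -> 0 < hook m v r.+1 l d) ->
    hook m v r.+1 l c <= hook m v r.+1 l d.
  by case: posnP => [->//|/[dup] /hE -> _ /(_ isT) /hE ->].
have Qh : is_plane_partition (hook m v r.+1 l).
  apply/and3P; split.
  - apply/forallP => i; apply/forallP => j; apply/forallP => j'; apply/implyP => lej.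
    by apply: hmono; rewrite !hpos /=; lia.
  - apply/forallP => i; apply/forallP => i'; apply/forallP => j; apply/implyP => lei.
    by apply: hmono; rewrite !hpos /=; lia.
  - rewrite sum_hook ?l_gt0 ?ltn_ord // -[X in _ == X](divnK vn).
    by rewrite eqn_pmul2r // /l; lia.
split=> //.
  (* A forced cell lies below the first row, hence in the first column, and everything to its right
     is zero. *)
  apply/subsetP => -[i j]; rewrite !inE /= => /andP[hij /existsP[i' /andP[lti' _]]].
  rewrite hij /=; apply/forallP => j'; apply/implyP => ltj'.
  rewrite (hE _ hij) -val_eqE /= ffunE /= (gtn_eqF (leq_ltn_trans _ lti')) //.
  by rewrite (gtn_eqF (leq_ltn_trans _ ltj')) //= neq_ltn v_gt0.
(* The only free cell is the right end of the first row: cells before it are not last of their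
   value, and cells below the corner are forced. *)
apply/cards1P; exists (ord0, r); apply/setP => -[i j]; rewrite !inE /= xpair_eqE.
have h0 (k : 'I_n) : k <= r -> 0 < hook m v r.+1 l (ord0, k) by rewrite hpos /= ltnS => ->.
apply/andP/andP => [[nA /andP[hij /forallP last_ij]]|[/eqP -> /eqP ->]].
  have i0 : i = ord0.
    apply: val_inj => /=; apply/eqP; apply: contraNT nA; rewrite -lt0n => i_gt0.
    rewrite hij /=; apply/existsP; exists ord0; rewrite i_gt0 /= (hE _ hij) hE //.
    by move: hij; rewrite !hpos /=; lia.
  split; first exact/eqP.
  have lejr : j <= r by move: hij; rewrite i0 hpos /= ltnS; case/orP => // /andP[/eqP ->].
  rewrite -val_eqE /= eqn_leq lejr leqNgt; apply/negP => ltjr.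
  by move: (last_ij r); rewrite ltjr i0 (hE _ (h0 r _)) // (hE _ (h0 j lejr)) eqxx.
rewrite h0 //=; split; first by apply/existsPn => i'.
apply/forallP => j'; apply/implyP => ltj'; rewrite (hE _ (h0 r (leqnn _))).
rewrite -val_eqE /= ffunE /= ltnS leqNgt ltj' /=.
by rewrite (gtn_eqF (leq_ltn_trans _ ltj')) //= neq_ltn v_gt0.
Qed.

Theorem theorem1p3 (n : nat) (hn : 1 <= n) :
  [/\ plbar n = pobar n %[mod 4],
      square_or_twice_square n -> pobar n = 2 %[mod 4]
    & ~ square_or_twice_square n -> pobar n = 0 %[mod 4]].
Proof.
(* Modulo 4 both counts depend only on the parity of the number that is doubled. *)
have double_mod4 k : 2 * k = 2 * odd k %[mod 4] by lia.
rewrite plbar_mod4 // pobar_mod4 // !(double_mod4 #|_|) double_mod4.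
rewrite sum_codivisors_odd //; have sqP := odd_odd_divisors _ hn.
split=> // [/sqP -> //|nsq].
by case: odd sqP => // -[/(_ isT)].
Qed.
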